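(* Let $E$ be a Banach space and let $\Omega$ be a closed, convex, bounded subset of $E$ such that $\Omega$ is equal to the closed convex hull of its extreme points, that is, $\Omega = \overline{\operatorname{co}}(\operatorname{ex} \Omega)$. Then for every $x \in \Omega$ there is a sequence $(x_n)_{n\ge1}$ in $\operatorname{ex} \Omega$ which is Cesàro summable to $x$.
   Context: Banach spaces are real. $\operatorname{ex}\Omega$ is the set of extreme points of $\Omega$, and $\overline{\operatorname{co}}$ denotes the norm-closed convex hull. A sequence $(x_n)$ is Cesàro summable to $x$ if $\frac{x_1 + \dots + x_N}{N} \to x$ in norm as $N \to \infty$. *)

(* Defs.v *)
From HB Require Import structures.
From mathcomp Require Import all_boot all_order all_algebra.
From mathcomp Require Import all_classical all_reals all_analysis.

Set Implicit Arguments.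
Unset Strict Implicit.
Unset Printing Implicit Defensive.

Import Order.TTheory GRing.Theory Num.Theory.
Import numFieldNormedType.Exports.

Local Open Scope classical_set_scope.
Local Open Scope ring_scope.

Definition extreme_points (R : numDomainType) (E : lmodType R) (A : set E) :
    set E :=
  [set x | A x /\
    forall (y z : E) (t : R), A y -> A z -> 0 < t < 1 ->
      x = t *: y + (1 - t) *: z -> y = x /\ z = x].

Definition convex_hull (R : numDomainType) (E : lmodType R) (A : set E) :
    set E :=
  smallest (@convex_set R E) A.

Definition closed_convex_hull (R : numFieldType) (E : normedModType R)
    (A : set E) : set E :=
  closure (convex_hull A).

(* Sequences are indexed from 0: [u n] stands for $x_{n+1}$, so that
   [series u N] is $x_1 + \dots + x_N$. *)
Definition cesaro_summable (R : numFieldType) (E : normedModType R)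
    (u : nat -> E) (x : E) : Prop :=
  (N%:R^-1 : R) *: series u N @[N --> \oo] --> x.

(* Main.v *)
Require Import Defs.
From HB Require Import structures.
From mathcomp Require Import all_boot all_order all_algebra.
From mathcomp Require Import all_classical all_reals all_analysis.
From mathcomp Require Import ring lra.

Import Order.TTheory GRing.Theory Num.Theory.
Import numFieldNormedType.Exports.

Local Open Scope classical_set_scope.
Local Open Scope ring_scope.

(** The theorem is a statement about an arbitrary set X of a normed space: the
    set C of all Cesaro limits of sequences of points of X contains X, is convex
    and is closed, hence contains the closed convex hull of X. Only the convexity
    and the closedness of C need an argument, and both come from running
    sequences inside one another.

    Write D(N) = (u_0 - x) + ... + (u_(N-1) - x) for the drift of u from x. Then
    u is Cesaro summable to x exactly when, for each e > 0, |D(N)| <= B + e N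
    for all N and some constant B (cesaro_summableP). This form holds from N = 0
    on and its constants add up when sequences are combined.

    Convexity (cesaro_limits_convex): if u and v are Cesaro summable to y and z,
    read off terms of u and of v so that among the first N terms exactly
    floor(t N) come from u. The drift of the merged sequence from
    t y + (1 - t) z is the sum of the drifts of u and v up to a multiple of
    z - y by a rounding error in [0, 1[.

    Closedness (cesaro_limits_closed): a limit point x of C has, for each k, a
    sequence U_k in X with drift at most B_k + N / (k + 1). Run U_0, then restart
    with U_1, then with U_2, and so on (cesaro_switching). If the passage to U_k
    waits until the time exceeds (k + 1) (B_0 + ... + B_k), the constants B_k
    paid at the switches are negligible, and the drift is bounded by a constant
    plus twice the sum of the rates 1 / (k + 1) in force so far, which is o(N). *)

(** * Linear bounds on the drift of a sequence *)

Definition drift {V : zmodType} (u : nat -> V) (x : V) : nat -> V :=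
  series (fun n => u n - x).

Lemma drift0 {V : zmodType} (u : nat -> V) (x : V) : drift u x 0 = 0.
Proof. by rewrite /drift /series /= big_geq. Qed.

Lemma driftS {V : zmodType} (u : nat -> V) (x : V) (N : nat) :
  drift u x N.+1 = drift u x N + (u N - x).
Proof. exact: seriesSr. Qed.

Lemma driftE {R : numDomainType} {V : lmodType R} (u : nat -> V) (x : V)
    (N : nat) : drift u x N = series u N - N%:R *: x.
Proof.
by rewrite /drift /series /= sumrB sumr_const_nat subn0 scaler_nat.
Qed.

Lemma drift_bound_ge0 {R : numFieldType} {E : normedModType R} (u : nat -> E)
    (x : E) (e B : R) :
  (forall N, `|drift u x N| <= B + e * N%:R) -> 0 <= B.
Proof. by move=> /(_ 0%N); rewrite drift0 normr0 mulr0 addr0. Qed.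

(** The finitely many initial times, where the mean is not yet close to [x], are
    absorbed in [B]; conversely [B] is absorbed in [e N] for large [N]. *)
Lemma cesaro_summableP {R : realType} {E : normedModType R} (u : nat -> E)
    (x : E) :
  cesaro_summable u x <->
  forall e : R, 0 < e -> exists B : R, forall N, `|drift u x N| <= B + e * N%:R.
Proof.
have meanE N : (0 < N)%N ->
    `|x - N%:R^-1 *: series u N| = N%:R^-1 * `|drift u x N|.
  move=> N0; have N0R : N%:R != 0 :> R by rewrite pnatr_eq0 -lt0n.
  rewrite distrC driftE -[X in _ = X * _]ger0_norm ?invr_ge0//.
  by rewrite -normrZ scalerBr scalerA mulVf// scale1r.
split=> [/cvgrPdist_le ux e e0 | bnd].
  have [N0 _ N0e] := ux e e0.
  exists (\sum_(n < N0) `|drift u x n|) => N.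
  have [NN0|N0N] := ltnP N N0.
    rewrite (bigD1 (Ordinal NN0))//= -addrA lerDl addr_ge0 ?sumr_ge0//.
    by rewrite mulr_ge0// ltW.
  apply: (@le_trans _ _ (e * N%:R)); last first.
    by rewrite lerDr sumr_ge0.
  have [->|Npos] := posnP N; first by rewrite drift0 normr0 mulr0.
  by have := N0e N N0N; rewrite /= meanE// mulrC ler_pdivrMr ?ltr0n.
apply/cvgrPdist_le => e e0.
have [B BP] := bnd (e / 2) (divr_gt0 e0 (ltr0Sn _ 1)).
have B0 := drift_bound_ge0 _ _ _ _ BP.
exists (Num.truncn (B / (e / 2))).+1 => // N /= NB.
have N0 : (0 < N)%N by apply: leq_ltn_trans NB.
rewrite meanE// mulrC ler_pdivrMr ?ltr0n//; apply: le_trans (BP N) _.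
have : B <= e / 2 * N%:R.
  rewrite mulrC -ler_pdivrMr ?divr_gt0//.
  by apply: ltW; apply: lt_le_trans (truncnS_gt _) _; rewrite ler_nat.
by move=> ?; lra.
Qed.

(** * Convex combinations *)

(** The number of terms taken from [u] before time [n] is [a n]; the other
    [n - a n] terms come from [v]. *)
Definition merge {T : Type} (a : nat -> nat) (u v : nat -> T) (n : nat) : T :=
  if a n.+1 == a n then v (n - a n)%N else u (a n).

Lemma series_merge {V : zmodType} (a : nat -> nat) (u v : nat -> V) :
  a 0%N = 0%N -> (forall n, a n <= a n.+1 <= (a n).+1)%N ->
  forall N, series (merge a u v) N = series u (a N) + series v (N - a N)%N.
Proof.
move=> a0 aS N.
suff [] : (a N <= N)%N /\
  series (merge a u v) N = series u (a N) + series v (N - a N)%N by [].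
elim: N => [|N [aN IH]].
  by rewrite a0; split=> //; rewrite /series /= !big_geq// addr0.
have /andP[aNl aNr] := aS N; split; first exact: leq_trans aNr _.
rewrite seriesSr IH /merge; case: eqP => [->|/eqP aneq].
  by rewrite subSn// seriesSr addrA.
have -> : a N.+1 = (a N).+1.
  by apply/eqP; rewrite eqn_leq aNr ltn_neqAle eq_sym aneq.
by rewrite subSS seriesSr addrAC.
Qed.

Definition cesaro_limits {R : numFieldType} {E : normedModType R} (X : set E) :
    set E :=
  [set x | exists u : nat -> E, (forall n, X (u n)) /\ cesaro_summable u x].

Lemma cesaro_limits_sub {R : realType} {E : normedModType R} (X : set E) :
  X `<=` cesaro_limits X.
Proof.
move=> x Xx; exists (fun=> x); split=> //; apply/cesaro_summableP => e e0.
exists 0 => N; rewrite driftE /series /= sumr_const_nat subn0 scaler_nat subrr.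
by rewrite normr0 add0r mulr_ge0// ltW.
Qed.

(** Merging along [a n = floor (t n)] uses [u] with frequency [t] for real [t],
    without passing through rational coefficients. *)
Lemma cesaro_limits_convex {R : realType} {E : normedModType R} (X : set E) :
  @convex_set R E (cesaro_limits X).
Proof.
apply/convex_setW => y z /set_mem[u [Xu uy]] /set_mem[v [Xv vz]] t t0 t1.
apply/mem_set; set c := t%:num *: y + (1 - t%:num) *: z.
suff : cesaro_limits X c by [].
have t0' := ltW t0; have t1' := ltW t1.
pose a n := Num.truncn (t%:num * n%:R).
have aP n : (a n)%:R <= t%:num * n%:R < (a n).+1%:R.
  by apply: truncn_itv; rewrite mulr_ge0.
have aS n : (a n <= a n.+1 <= (a n).+1)%N.
  have /andP[h1 h2] := aP n; have /andP[h3 h4] := aP n.+1.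
  rewrite -[X in X && _]ltnS -[X in _ && X]ltnS -!(ltr_nat R).
  move: h1 h2 h3 h4; rewrite -[n.+1]addn1 -[(a n).+2]addn1.
  rewrite natrD.
  rewrite natrD mulrDr mulr1 => h1 h2 h3 h4; apply/andP; split; first lra.
  by move: h4; lra.
have a0 : a 0%N = 0%N by rewrite /a mulr0 truncn0.
have aN N : (a N <= N)%N.
  have /andP[h1 _] := aP N; rewrite -(ler_nat R); apply: le_trans h1 _.
  by rewrite ler_piMl.
exists (merge a u v); split=> [n|].
  by rewrite /merge; case: ifP.
apply/cesaro_summableP => e e0.
have /cesaro_summableP/(_ e e0)[B BP] := uy.
have /cesaro_summableP/(_ e e0)[C CP] := vz.
exists (B + C + `|z - y|) => N.
have -> : drift (merge a u v) c N =
    drift u y (a N) + drift v z (N - a N)%N +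
    (t%:num * N%:R - (a N)%:R) *: (z - y).
  rewrite !driftE (series_merge _ _ _ a0 aS) natrB//.
  (* The term in [z - y] is the rounding error made by floor on [t N]. *)
  have -> : N%:R *: c = (a N)%:R *: y + (N%:R - (a N)%:R) *: z -
      (t%:num * N%:R - (a N)%:R) *: (z - y).
    rewrite [in RHS]scalerBr opprB addrACA -scalerDl -scalerBl.
    rewrite scalerDr !scalerA.
    by congr (_ *: y + _ *: z); ring.
  by rewrite opprB opprD addrCA addrACA addrC.
apply: le_trans (ler_normD _ _) _; apply: le_trans (lerD (ler_normD _ _) (lexx _)) _.
have := BP (a N); have := CP (N - a N)%N; rewrite natrB// => hC hB.
have : `|(t%:num * N%:R - (a N)%:R) *: (z - y)| <= `|z - y|.
  rewrite normrZ ler_piMl//; have /andP[h1 h2] := aP N.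
  by rewrite ger0_norm ?subr_ge0// lerBlDl; move: h2; rewrite -natr1; lra.
by move=> ?; lra.
Qed.

(** * Closedness *)

(** Each [U k] runs from its index 0 for a finite time; for [0 < k], [g k] is the
    earliest time at which it may start. *)
Section slow_switching.
Context {T : Type} (g : nat -> nat) (U : nat -> nat -> T).

Fixpoint switching_state (n : nat) : nat * nat :=
  if n is m.+1 then
    let: (k, i) := switching_state m in
    if (g k.+1 <= n)%N then (k.+1, 0%N) else (k, i.+1)
  else (0%N, 0%N).

Definition switching (n : nat) : T :=
  U (switching_state n).1 (switching_state n).2.

Let stage n := (switching_state n).1.

Lemma switching_stageS n : (stage n <= stage n.+1)%N.
Proof.
by rewrite /stage /=; case: (switching_state n) => k i /=; case: ifP => /=.
Qed.

Lemma switching_stage_mono m n : (m <= n)%N -> (stage m <= stage n)%N.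
Proof.
exact: (homo_leq (@leqnn) (fun y x z => @leq_trans y x z) switching_stageS).
Qed.

Lemma switching_stage_threshold n : (0 < stage n)%N -> (g (stage n) <= n)%N.
Proof.
elim: n => // n; rewrite /stage /=.
case: (switching_state n) => k i /= IH; case: ifP => //= _ /IH; exact: leqW.
Qed.

Lemma switching_stage_unbounded k : exists n, (k <= stage n)%N.
Proof.
elim: k => [|k [n kn]]; first by exists 0%N.
exists (maxn n (g k.+1)).+1.
set m := maxn n _; have := switching_stage_mono _ _ (leq_maxl n (g k.+1)).
rewrite -/m /stage /=; move: kn; rewrite /stage.
case: (switching_state n) => k1 i1 /=.
case E : (switching_state m) => [k2 i2] /= kk1 k12.
case: ifPn => /= [_|]; first exact: leq_ltn_trans (leq_trans kk1 k12) _.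
have := leq_trans kk1 k12; rewrite leq_eqVlt => /predU1P[<-|]//.
by rewrite (leqW (leq_maxr _ _)).
Qed.

End slow_switching.

(** A drift bound at each rate [e], with a sequence depending on [e], yields a
    single sequence good for all [e]: run the sequences of rates [1 / (k + 1)]
    one after the other, switching so late that the constants are cheap. *)
Lemma cesaro_switching {R : realType} {E : normedModType R} (X : set E)
    (x : E) :
  (forall e : R, 0 < e -> exists u : nat -> E, (forall n, X (u n)) /\
    exists B : R, forall N, `|drift u x N| <= B + e * N%:R) ->
  cesaro_limits X x.
Proof.
move=> approx; pose eps k : R := k.+1%:R^-1.
have eps0 k : 0 < eps k by rewrite invr_gt0.
have /choice[U /all_and2[XU /choice[B BP]]] k := approx (eps k) (eps0 k).
have B0 k : 0 <= B k := drift_bound_ge0 _ _ _ _ (BP k).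
pose budget k := \sum_(j < k) B j.
pose g k := (Num.truncn (k.+1%:R * budget k.+1)).+1.
have gP k n : (g k <= n)%N -> budget k.+1 <= eps k * n%:R.
  move=> kn; rewrite mulrC ler_pdivlMr// mulrC.
  by apply: ltW; apply: lt_le_trans (truncnS_gt _) _; rewrite ler_nat.
pose stage n := (switching_state g n).1.
pose age n := (switching_state g n).2.
pose w := switching g U.
exists w; split=> [n|]; first exact: XU.
(* The difference of the two drifts is the contribution of the completed runs:
   each run [j] has cost its constant [B j] and its rate times its length. *)
have inv n : `|drift w x n - drift (U (stage n)) x (age n)| +
    eps (stage n) * (age n)%:R <= \sum_(m < n) eps (stage m) + budget (stage n).
  elim: n => [|n IH].
    by rewrite !drift0 subrr normr0 mulr0 /budget !big_ord0.
  rewrite big_ord_recr /= driftS /w /switching.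
  move: IH; rewrite /stage /age /=.
  case: (switching_state g n) => k i /= IH.
  have Dw : drift w x n + (U k i - x) =
      drift w x n - drift (U k) x i + drift (U k) x i.+1.
    by rewrite driftS [RHS]addrA subrK.
  rewrite -/w Dw; case: ifP => _ /=; last first.
    by rewrite addrK -natr1; lra.
  rewrite drift0 subr0 mulr0 addr0 /budget big_ord_recr /= -/(budget k).
  apply: le_trans (ler_normD _ _) _.
  by have := BP k i.+1; rewrite -natr1; lra.
(* In stage 0 the only constant is [B 0]. Later, by the choice of [g], all
   constants together cost at most the current rate times [n], which is at most
   the sum of the past rates since rates only decrease. *)
have bound n : `|drift w x n| <= B 0%N + 2 * \sum_(m < n) eps (stage m).
  have le1 : `|drift w x n| <= \sum_(m < n) eps (stage m) + budget (stage n).+1.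
    rewrite -[drift w x n](subrK (drift (U (stage n)) x (age n))).
    apply: le_trans (ler_normD _ _) _; rewrite /budget big_ord_recr /=.
    rewrite -/(budget _).
    by have := BP (stage n) (age n); have := inv n; lra.
  suff : budget (stage n).+1 <= B 0%N + \sum_(m < n) eps (stage m) by lra.
  have S0 : 0 <= \sum_(m < n) eps (stage m) by apply: sumr_ge0 => i _; exact: ltW.
  have [s0|spos] := posnP (stage n).
    by rewrite s0 /budget big_ord_recr big_ord0 /= add0r lerDl.
  apply: le_trans (gP _ _ (switching_stage_threshold g n spos)) _.
  apply: (@le_trans _ _ (\sum_(m < n) eps (stage m))); last by rewrite lerDr.
  rewrite mulr_natr -[n in _ *+ n]card_ord -sumr_const.
  apply: ler_sum => i _; rewrite lef_pV2 ?posrE// ler_nat ltnS.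
  by apply: switching_stage_mono; exact: ltnW.
apply/cesaro_summableP => e e0.
(* After [n0] the rates are at most [e / 2]; before, they are at most 1. *)
have [n0 n0P] := switching_stage_unbounded g (Num.truncn (e / 2)^-1).
have tail m : (n0 <= m)%N -> eps (stage m) <= e / 2.
  move=> n0m; rewrite -[e / 2]invrK lef_pV2 ?posrE ?invr_gt0 ?divr_gt0//.
  apply: ltW; apply: lt_le_trans (truncnS_gt _) _; rewrite ler_nat ltnS.
  exact: leq_trans n0P (switching_stage_mono g _ _ n0m).
exists (B 0%N + 2 * n0%:R) => N; apply: le_trans (bound N) _.
suff : \sum_(m < N) eps (stage m) <= n0%:R + e / 2 * N%:R.
  by move=> ?; lra.
elim: N => [|N IH]; first by rewrite big_ord0 mulr0 addr0.
have [n0N|Nn0] := leqP n0 N.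
  by rewrite big_ord_recr /= -[N.+1%:R]natr1; have := tail N n0N; lra.
apply: (@le_trans _ _ N.+1%:R); last first.
  rewrite -[leLHS]addr0 lerD ?ler_nat// mulr_ge0// ltW// divr_gt0//.
rewrite -[X in _ <= X%:R]card_ord -sumr_const; apply: ler_sum => i _.
by rewrite invf_le1// ler1n.
Qed.

Lemma cesaro_limits_closed {R : realType} {E : normedModType R} (X : set E) :
  closed (cesaro_limits X).
Proof.
move=> x clx; apply: cesaro_switching => e e0.
have e20 : 0 < e / 2 by rewrite divr_gt0.
have [y [[u [Xu /cesaro_summableP/(_ _ e20)[B BP]]] xy]] :=
  clx _ (nbhsx_ballx x (e / 2) e20).
exists u; split=> //; exists B => N.
have -> : drift u x N = drift u y N + N%:R *: (y - x).
  by rewrite !driftE scalerBr addrA subrK.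
apply: le_trans (ler_normD _ _) _; rewrite normrZ normr_nat.
have : `|y - x| <= e / 2 by move: xy; rewrite -ball_normE /= distrC => /ltW.
move=> /(ler_wpM2l (ler0n R N)); have := BP N; lra.
Qed.

Theorem proposition3 (R : realType) (E : completeNormedModType R)
    (Omega : set E)
    (Omega_closed : closed Omega)
    (Omega_convex : @convex_set R E Omega)
    (Omega_bounded : bounded_set Omega)
    (Omega_hull : Omega = closed_convex_hull (extreme_points Omega))
    (x : E) (Omega_x : Omega x) :
  exists u : nat -> E,
    (forall n, extreme_points Omega (u n)) /\ cesaro_summable u x.
Proof.
move: Omega_x; rewrite {1}Omega_hull.
rewrite /closed_convex_hull closureE => Omega_x.
apply: (smallest_sub (cesaro_limits_closed (extreme_points Omega)) _ Omega_x).
apply: smallest_sub; first exact: cesaro_limits_convex.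
exact: cesaro_limits_sub.
Qed.
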